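(* Let $0\le t\le T\le 1$ and let $f:[-1,1]^n\to\mathbb{R}$ be multilinear. With $X(t)$ the continuous revealing process and $\epsilon=T-t$, \[ \left(\mathbb{E}|f(X(t))|^{2+\epsilon}\right)^{\frac1{2+\epsilon}}\le\left(\mathbb{E}|f(X(T))|^2\right)^{1/2}. \]
   Context: Continuous revealing process: let $x$ be uniform on $\{-1,1\}^n$ and let $\tau_1,\dots,\tau_n$ be independent uniform on $[0,1]$ (independent of $x$); define $X(s)\in[-1,1]^n$ for $s\in[0,1]$ by $X_i(s)=x_i$ if $\tau_i\le s$ and $X_i(s)=0$ otherwise. A function $f:[-1,1]^n\to\mathbb{R}$ is multilinear if it is of the form $\sum_{S\subseteq[n]}c_S\prod_{j\in S}x_j$. *)

(* Defs.v *)
From HB Require Import structures.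
From mathcomp Require Import all_boot all_order all_algebra.
From mathcomp Require Import all_classical all_reals all_analysis.

Set Implicit Arguments.
Unset Strict Implicit.
Unset Printing Implicit Defensive.

Import Order.TTheory GRing.Theory Num.Theory.

Local Open Scope classical_set_scope.
Local Open Scope ring_scope.

(* Points of R^n are [n.-tuple R], which carries the product sigma-algebra. *)

Definition cube (R : realType) (n : nat) : set (n.-tuple R) :=
  [set y | forall i, -1 <= tnth y i <= 1].

Definition sign_cube (R : realType) (n : nat) : set (n.-tuple R) :=
  [set y | forall i, tnth y i = -1 \/ tnth y i = 1].

(* A function on [-1, 1]^n is represented by a total function of which only the
   restriction to the cube is constrained. *)
Definition multilinear_on_cube (R : realType) (n : nat) (f : n.-tuple R -> R) : Prop :=
  exists c : {set 'I_n} -> R, forall y, cube y ->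
    f y = \sum_(S : {set 'I_n}) c S * \prod_(j in S) tnth y j.

Definition mutually_independent (d d' : measure_display)
    (Omega : measurableType d) (E : measurableType d') (R : realType)
    (P : probability Omega R) (I : finType) (Z : I -> Omega -> E) : Prop :=
  forall (J : {set I}) (B : I -> set E), (forall i, measurable (B i)) ->
    P (\bigcap_(i in [set i | i \in J]) (Z i @^-1` B i)) =
    (\prod_(i in J) P (Z i @^-1` B i))%E.

Definition independent2 (d d1 d2 : measure_display)
    (Omega : measurableType d) (E1 : measurableType d1) (E2 : measurableType d2)
    (R : realType) (P : probability Omega R)
    (Y : Omega -> E1) (Z : Omega -> E2) : Prop :=
  forall (A : set E1) (B : set E2), measurable A -> measurable B ->
    P (Y @^-1` A `&` Z @^-1` B) = (P (Y @^-1` A) * P (Z @^-1` B))%E.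

Record revealing_data (d : measure_display) (Omega : measurableType d)
    (R : realType) (P : probability Omega R) (n : nat)
    (x tau : {RV P >-> n.-tuple R}) : Prop := RevealingData {
  x_sign : forall w, sign_cube (x w) ;
  x_uniform : forall v, sign_cube v -> P (x @^-1` [set v]) = ((2 ^+ n)^-1)%:E ;
  tau_uniform : forall (i : 'I_n) (A : set R), measurable A ->
    P ((fun w => tnth (tau w) i) @^-1` A) = uniform_prob (@ltr01 R) A ;
  tau_independent :
    mutually_independent P (fun (i : 'I_n) (w : Omega) => tnth (tau w) i) ;
  x_tau_independent : independent2 P x tau }.

Definition revealing_process (R : realType) (n : nat) (Omega : Type)
    (x tau : Omega -> n.-tuple R) (s : R) (w : Omega) : n.-tuple R :=
  [tuple if tnth (tau w) i <= s then tnth (x w) i else 0 | i < n].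

(* Main.v *)
(* The mean over the process at time s is a product measure giving mass 1 - s to
   0 and s/2 to each of 1 and -1. A multilinear function is a(y) + y_0 b(y) in
   its first coordinate, so induction on n reduces the theorem to n = 1:
   integrating out y_0 by the case n = 1 leaves the L^(p/2) norm of a^2 + T b^2,
   which Minkowski's inequality (p = 2 + e >= 2, e = T - t) splits into the
   squared L^p norms of a and b.
   For n = 1, the two-point Bonami inequality
     (|a + b|^p + |a - b|^p) / 2 <= (a^2 + (p - 1) b^2)^(p/2)
   leaves (1 - t) |a|^p + t M^(p/2) <= m^(p/2) with M = a^2 + (1 + e) b^2 and
   m = a^2 + (t + e) b^2, and this follows from the Bernoulli bound
   (M/m)^(e/2) <= 1 + (e/2) (M/m - 1). *)

Require Import Defs.
From HB Require Import structures.
From mathcomp Require Import all_boot all_order all_algebra.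
From mathcomp Require Import all_classical all_reals all_analysis.
From mathcomp Require Import measurable_realfun.
From mathcomp Require Import ring lra.
Import Order.TTheory GRing.Theory Num.Theory.
Local Open Scope classical_set_scope.
Local Open Scope ring_scope.

(** * Real inequalities: tangent bounds, the two-point inequality, one coordinate *)

Section PowerInequalities.
Set Implicit Arguments.
Unset Strict Implicit.
Variable R : realType.
Implicit Types a b e p q s t x y z : R.

(** Young's inequality for the product of z and 1 with conjugate exponents q and q / (q - 1). The
    exponent q = 1 has no finite conjugate and is treated apart. *)
Lemma powR_ge_tangent z q : 0 <= z -> 1 <= q -> 1 + q * (z - 1) <= z `^ q.
Proof.
move=> z0; rewrite le_eqVlt => /predU1P[<-|q1]; first by rewrite powRr1//; lra.
have q0 : 0 < q by lra.
have r0 : 0 < q / (q - 1) by rewrite divr_gt0//; lra.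
have qr : q^-1 + (q / (q - 1))^-1 = 1 by field; apply/andP; split; lra.
have := @conjugate_powR R z 1 q _ z0 ler01 q0 r0 qr.
rewrite powR1 mulr1 => h.
have -> : z `^ q = q * (z `^ q / q + 1 / (q / (q - 1))) - (q - 1).
  by field; apply/andP; split; lra.
nra.
Qed.

(** The preceding bound with exponent 1 / e at the point z^e, solved for z^e. *)
Lemma powR_le_tangent z e : 0 <= z -> 0 <= e <= 1 -> z `^ e <= 1 + e * (z - 1).
Proof.
move=> z0 /andP[]; rewrite le_eqVlt => /predU1P[<- _|e0 e1].
  by rewrite powRr0 mul0r addr0.
have := @powR_ge_tangent (z `^ e) e^-1 (powR_ge0 _ _).
rewrite -powRrM mulfV ?gt_eqF// powRr1// => /(_ _)/wrap[].
  by rewrite invf_ge1.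
move=> h.
have -> : z `^ e = 1 + e * (1 + e^-1 * (z `^ e - 1) - 1).
  by field; lra.
nra.
Qed.

Lemma ge0_derive_le (h h' : R -> R) x : 0 <= x ->
  (forall y, 0 <= y <= x -> is_derive y 1 h (h' y)) ->
  (forall y, 0 <= y <= x -> 0 <= h' y) -> h 0 <= h x.
Proof.
move=> x0 dh h'0.
have df y : y \in `[0, x]%R -> derivable h y 1.
  by rewrite in_itv/= => /dh[].
apply: (@ger0_derive1_le_cc R h 0 x) => //; rewrite ?in_itv/= ?lexx ?x0//.
- by move=> y yx; apply: df; apply: subset_itv_oo_cc yx.
- move=> y; rewrite in_itv/= => /andP[/ltW y0 /ltW yx].
  have y0x : 0 <= y <= x by rewrite y0.
  by rewrite derive1E; case: (dh _ y0x) => _ ->; apply: h'0.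
- exact: derivable_within_continuous.
Qed.

Lemma is_derive_powR_addl s p y : 0 < 1 + s * y ->
  is_derive y 1 (fun z => (1 + s * z) `^ p) (s * (p * (1 + s * y) `^ (p - 1))).
Proof.
move=> y0.
have dl : is_derive y 1 (fun z => 1 + s * z) s.
  by apply: is_derive_eq; rewrite /GRing.scale/=; lra.
have := @is_derive1_comp R (@powR R ^~ p) (fun z => 1 + s * z) y _ _
  (@is_derive1_powR R p _ y0) dl.
by rewrite mulrC.
Qed.

(* For [2 <= p <= 3] the fourth and later even binomial coefficients of
   [(1 + x) ^ p] are nonpositive; the second derivative sees this as concavity
   of [z ^ (p - 2)]. *)
Lemma two_point_quadratic_lt1 e x : 0 <= e <= 1 -> 0 <= x < 1 ->
  (1 + x) `^ (2 + e) + (1 - x) `^ (2 + e) <= 2 + (2 + e) * (1 + e) * x ^+ 2.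
Proof.
move=> e01 /andP[x0 x1]; have /andP[e0 e1] := e01.
have dp p y : 0 <= y <= x ->
    is_derive y 1 (fun z => (1 + z) `^ p) (p * (1 + y) `^ (p - 1)).
  move=> /andP[y0 yx].
  have := @is_derive_powR_addl 1 p y; rewrite !mul1r => /(_ _)/wrap[]; first lra.
  by under eq_fun do rewrite mul1r.
have dm p y : 0 <= y <= x ->
    is_derive y 1 (fun z => (1 - z) `^ p) (- (p * (1 - y) `^ (p - 1))).
  move=> /andP[y0 yx].
  have := @is_derive_powR_addl (-1) p y; rewrite !mulN1r => /(_ _)/wrap[]; first lra.
  by under eq_fun do rewrite mulN1r.
(* Up to the factor 2 + e, this is the derivative of the right side minus the left side. It vanishes
   at 0, and its own derivative is nonnegative because the tangent bounds at 1 + z and 1 - z add up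
   to (1 + z)^e + (1 - z)^e <= 2. *)
have first (y : R) : 0 <= y <= x ->
    0 <= 2 * (1 + e) * y - (1 + y) `^ (1 + e) + (1 - y) `^ (1 + e).
  move=> /andP[y0 yx].
  pose h (z : R) := 2 * (1 + e) * z - (1 + z) `^ (1 + e) + (1 - z) `^ (1 + e).
  pose h' (z : R) := 2 * (1 + e) - (1 + e) * (1 + z) `^ e - (1 + e) * (1 - z) `^ e.
  have -> : 0 = h 0 by rewrite /h mulr0 !addr0 subr0 powR1; lra.
  apply: (@ge0_derive_le h h') => // z /andP[z0 zy].
    have zx : 0 <= z <= x by rewrite z0 (le_trans zy).
    have d1 := dp (1 + e) _ zx; have d2 := dm (1 + e) _ zx.
    apply: is_derive_eq; rewrite /h' /GRing.scale/=.
    have -> : 1 + e - 1 = e by ring.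
    ring.
  have := @powR_le_tangent (1 + z) e ltac:(lra) e01.
  have := @powR_le_tangent (1 - z) e ltac:(lra) e01.
  rewrite /h'; nra.
pose h (z : R) := 2 + (2 + e) * (1 + e) * z ^+ 2 - (1 + z) `^ (2 + e) - (1 - z) `^ (2 + e).
pose h' (z : R) := (2 + e) * (2 * (1 + e) * z - (1 + z) `^ (1 + e) + (1 - z) `^ (1 + e)).
have h0 : h 0 = 0 by rewrite /h expr0n/= mulr0 !addr0 subr0 powR1; lra.
suff : h 0 <= h x by rewrite h0 /h; lra.
apply: (@ge0_derive_le h h' _ x0) => z zx.
  have d1 := dp (2 + e) _ zx; have d2 := dm (2 + e) _ zx.
  apply: is_derive_eq; rewrite /h' /GRing.scale/=.
  have -> : 2 + e - 1 = 1 + e by ring.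
  ring.
by rewrite /h'; apply: mulr_ge0; [lra|exact: first].
Qed.

(** Only x = 1 is new: differentiating (1 - x)^p used a positive base, so the endpoint is reached as
    a limit. *)
Lemma two_point_quadratic e x : 0 <= e <= 1 -> 0 <= x <= 1 ->
  (1 + x) `^ (2 + e) + (1 - x) `^ (2 + e) <= 2 + (2 + e) * (1 + e) * x ^+ 2.
Proof.
move=> e01 /andP[x0]; have /andP[e0 e1] := e01.
rewrite le_eqVlt => /predU1P[->|x1]; last first.
  by apply: two_point_quadratic_lt1; rewrite // x0.
rewrite subrr powR0 ?gt_eqF//; last lra.
rewrite addr0; set B := (X in _ <= X).
have B0 : 0 <= B by rewrite /B; nra.
have p0 : 0 < 2 + e by lra.
(* The nonnegative term (1 - y)^p is dropped and a root taken, so that the limit concerns only the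
   affine function 1 + y. *)
have key (y : R) : 0 <= y < 1 -> 1 + y <= B `^ (2 + e)^-1.
  move=> y01; have /andP[y0 y1] := y01.
  have -> : 1 + y = ((1 + y) `^ (2 + e)) `^ (2 + e)^-1.
    by rewrite -powRrM mulfV ?gt_eqF// powRr1//; lra.
  apply: ge0_ler_powR; rewrite ?nnegrE ?powR_ge0 ?invr_ge0 ?(ltW p0)//.
  have := two_point_quadratic_lt1 e01 y01.
  have : (2 + e) * (1 + e) * y ^+ 2 <= (2 + e) * (1 + e) * 1 ^+ 2.
    by apply: ler_wpM2l; nra.
  have := powR_ge0 (1 - y) (2 + e); rewrite /B; lra.
(* The limit is taken along y = 1 - d; for d > 1 the point y = 0 is enough. *)
have le2 : 1 + 1 <= B `^ (2 + e)^-1.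
  apply/ler_addgt0Pr => d d0.
  have [d1|d1] := leP d 1; last first.
    by have := key 0; rewrite lexx ltr01 => /(_ isT); lra.
  have d01 : 0 <= 1 - d < 1 by lra.
  by have := key _ d01; lra.
have -> : B = (B `^ (2 + e)^-1) `^ (2 + e).
  by rewrite -powRrM mulVf ?gt_eqF// powRr1.
by apply: ge0_ler_powR; rewrite ?nnegrE ?powR_ge0 ?(ltW p0)//; lra.
Qed.

Lemma norm_powR_sqr a p : `|a| `^ p = (a ^+ 2) `^ (p / 2).
Proof.
rewrite -real_normK ?num_real// -powR_mulrn// -powRrM.
by congr (_ `^ _); field.
Qed.

(** By symmetry and homogeneity only c = b / a in [0, 1] matters. There the quadratic bound is
    exactly twice the tangent bound for z^(1 + e/2) at z = 1 + (1 + e) c^2. *)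
Lemma two_point_bonami e a b : 0 <= e <= 1 ->
  `|a + b| `^ (2 + e) + `|a - b| `^ (2 + e) <=
  2 * (a ^+ 2 + (1 + e) * b ^+ 2) `^ ((2 + e) / 2).
Proof.
move=> e01; have /andP[e0 e1] := e01.
wlog ba : a b / `|b| <= `|a|.
  move=> H; have [/H//|ab] := leP `|b| `|a|.
  (* Exchanging a and b fixes the left side and, when |a| < |b|, does not increase the right side
     since e >= 0. *)
  have := H b a (ltW ab); rewrite (addrC b) distrC => /le_trans; apply.
  rewrite ler_pM2l//; apply: ge0_ler_powR; rewrite ?nnegrE; [lra|nra|nra|].
  have : `|a| ^+ 2 <= `|b| ^+ 2 by rewrite ler_sqr ?nnegrE// ltW.
  by rewrite !real_normK ?num_real//; nra.
have [a0|a0] := eqVneq a 0.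
  have b0 : b = 0 by apply/eqP; rewrite -normr_le0 (le_trans ba)// a0 normr0.
  rewrite a0 b0 addr0 subr0 normr0 powR0 ?addr0; last lra.
  by rewrite mulr_ge0// powR_ge0.
wlog c0 : b ba / 0 <= b / a.
  move=> H; have [/H|c0] := leP 0 (b / a); first exact.
  have := H (- b); rewrite normrN mulNr sqrrN opprK addrC.
  by apply => //; lra.
have -> : b = a * (b / a) by rewrite mulrCA mulfV// mulr1.
have c1 : b / a <= 1.
  by rewrite -(ger0_norm c0) normf_div ler_pdivrMr ?normr_gt0// mul1r.
set c := b / a in c0 c1 *.
have -> : a + a * c = a * (1 + c) by ring.
have -> : a - a * c = a * (1 - c) by ring.
have -> : a ^+ 2 + (1 + e) * (a * c) ^+ 2 = a ^+ 2 * (1 + (1 + e) * c ^+ 2) by ring.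
rewrite !normrM (ger0_norm (_ : 0 <= 1 + c)) ?(ger0_norm (_ : 0 <= 1 - c)); try lra.
rewrite (@powRM _ `|a| (1 + c)) ?(@powRM _ `|a| (1 - c)) ?(@powRM _ (a ^+ 2)) ?sqr_ge0//; try nra.
rewrite -norm_powR_sqr -mulrDr mulrCA ler_wpM2l ?powR_ge0//.
apply: (le_trans (@two_point_quadratic e c e01 _)); first by rewrite c0.
have := @powR_ge_tangent (1 + (1 + e) * c ^+ 2) ((2 + e) / 2) ltac:(nra) ltac:(lra).
nra.
Qed.

Lemma three_point_bound e t a b : 0 <= e <= 1 -> 0 <= t <= 1 ->
  (1 - t) * `|a| `^ (2 + e)
    + t * (a ^+ 2 + (1 + e) * b ^+ 2) `^ ((2 + e) / 2)
  <= (a ^+ 2 + (t + e) * b ^+ 2) `^ ((2 + e) / 2).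
Proof.
move=> e01 t01; have /andP[e0 e1] := e01; have /andP[t0 t1] := t01.
have qE : (2 + e) / 2 = 1 + e / 2 by field.
have powE z : 0 <= z -> z `^ (1 + e / 2) = z * z `^ (e / 2).
  move=> z0; rewrite powRD ?powRr1//.
  by rewrite gt_eqF//; lra.
rewrite norm_powR_sqr qE; set m := a ^+ 2 + (t + e) * b ^+ 2.
set M := a ^+ 2 + _ * _.
have a20 := sqr_ge0 a; have b20 := sqr_ge0 b.
have m0 : 0 <= m by rewrite /m; nra.
have M0 : 0 <= M by rewrite /M; nra.
rewrite !powE//.
have am : (a ^+ 2) `^ (e / 2) <= m `^ (e / 2).
  by apply: ge0_ler_powR; rewrite ?nnegrE//; [lra|rewrite /m; nra].
(* The main argument divides by m. If m = 0, then a, t b^2 and e b^2 vanish, hence so does t M. *)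
have [m00|mN0] := eqVneq m 0.
  have a0 : a ^+ 2 = 0 by move: m00; rewrite /m; nra.
  rewrite m00 a0 !mul0r mulr0 add0r.
  have tb : t * b ^+ 2 = 0 by move: m00; rewrite /m; nra.
  have eb : e * b ^+ 2 = 0 by move: m00; rewrite /m; nra.
  suff -> : t * (M * M `^ (e / 2)) = 0 by [].
  rewrite mulrA (_ : t * M = 0) ?mul0r// /M a0.
  by rewrite add0r mulrDl mul1r mulrDr tb eb mulr0 addr0.
have mp : 0 < m by rewrite lt_neqAle eq_sym mN0.
have Mm : M `^ (e / 2) <= m `^ (e / 2) * (1 + e / 2 * (M / m - 1)).
  have {1}-> : M = m * (M / m) by rewrite mulrCA mulfV// mulr1.
  have Mm0 : 0 <= M / m by rewrite divr_ge0.
  rewrite powRM// ler_wpM2l ?powR_ge0//.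
  by apply: powR_le_tangent => //; lra.
set Z := m `^ (e / 2) in am Mm *.
have Z0 : 0 <= Z by exact: powR_ge0.
have tMm : t * M <= m.
  rewrite -subr_ge0.
  have -> : m - t * M = (1 - t) * (a ^+ 2 + e * b ^+ 2) by rewrite /m /M; ring.
  by apply: mulr_ge0; [rewrite subr_ge0|rewrite addr_ge0// mulr_ge0].
(* This is the claim with the factor m^(e/2) removed. Since M - m = (1 - t) b^2 and t M <= m, the
   Bernoulli correction costs at most (e/2) (1 - t) b^2, half of the slack e (1 - t) b^2 contained
   in m. *)
have core : (1 - t) * a ^+ 2 + t * M * (1 + e / 2 * (M / m - 1)) <= m.
  have -> : M / m - 1 = (1 - t) * b ^+ 2 / m.
    by rewrite /M /m; field; exact: mN0.
  have -> : t * M * (1 + e / 2 * ((1 - t) * b ^+ 2 / m)) =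
            t * M + e / 2 * ((1 - t) * b ^+ 2) * (t * M / m) by field.
  have h1 : t * M / m <= 1 by rewrite ler_pdivrMr// mul1r.
  have h2 : 0 <= e / 2 * ((1 - t) * b ^+ 2).
    by apply: mulr_ge0; [rewrite divr_ge0|apply: mulr_ge0; rewrite ?subr_ge0].
  have h3 : e / 2 * ((1 - t) * b ^+ 2) * (t * M / m) <= e / 2 * ((1 - t) * b ^+ 2).
    by rewrite -[leRHS]mulr1 ler_wpM2l.
  have mE : m = (1 - t) * a ^+ 2 + t * M + e * ((1 - t) * b ^+ 2).
    by rewrite /m /M; ring.
  rewrite [leRHS]mE; lra.
have s1 : (1 - t) * (a ^+ 2 * (a ^+ 2) `^ (e / 2)) <= (1 - t) * a ^+ 2 * Z.
  by rewrite -mulrA ler_wpM2l//; [lra|rewrite ler_wpM2l].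
have s2 : t * (M * M `^ (e / 2)) <= t * M * (1 + e / 2 * (M / m - 1)) * Z.
  by rewrite mulrA -[leRHS]mulrA [_ * Z]mulrC ler_wpM2l// mulr_ge0.
apply: (le_trans (lerD s1 s2)).
by rewrite -mulrDl ler_wpM2r.
Qed.

(** The case n = 1 raised to the power 2 + e, with T = t + e: the mean of (a + y b)^2 at time T is
    a^2 + T b^2. *)
Lemma single_coordinate_bound e t a b : 0 <= e <= 1 -> 0 <= t <= 1 ->
  (1 - t) * `|a| `^ (2 + e)
    + t / 2 * (`|a + b| `^ (2 + e) + `|a - b| `^ (2 + e))
  <= (a ^+ 2 + (t + e) * b ^+ 2) `^ ((2 + e) / 2).
Proof.
move=> e01 t01; apply: le_trans (@three_point_bound e t a b e01 t01).
have := @two_point_bonami e a b e01; have /andP[t0 t1] := t01.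
rewrite lerD2l => h; set M := (_ + _) `^ _ in h *.
have -> : t * M = t / 2 * (2 * M) by field.
by rewrite ler_wpM2l// divr_ge0.
Qed.

End PowerInequalities.

(** * The mean at time s as a recursion on coordinates, and its hypercontractivity *)

Section RevealMean.
Set Implicit Arguments.
Unset Strict Implicit.
Variable R : realType.
Implicit Types s t T q : R.

(* Expectation of [g (X s)], with the coordinates of [X s] drawn one at a time. *)
Fixpoint reveal_mean (s : R) (n : nat) : (n.-tuple R -> R) -> R :=
  match n with
  | 0 => fun g => g [tuple]
  | m.+1 => fun g =>
      (1 - s) * reveal_mean s (fun y : m.-tuple R => g [tuple of 0 :: y])
      + s / 2 * (reveal_mean s (fun y : m.-tuple R => g [tuple of 1 :: y])
                 + reveal_mean s (fun y : m.-tuple R => g [tuple of -1 :: y]))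
  end.

Lemma reveal_mean_linear s n (g h : n.-tuple R -> R) (c d : R) :
  reveal_mean s (fun y => c * g y + d * h y) =
  c * reveal_mean s g + d * reveal_mean s h.
Proof. by elim: n g h => //= n IH g h; rewrite !IH; ring. Qed.

Lemma reveal_meanZ s n (g : n.-tuple R -> R) (c : R) :
  reveal_mean s (fun y => c * g y) = c * reveal_mean s g.
Proof. by elim: n g => //= n IH g; rewrite !IH; ring. Qed.

Lemma ler_reveal_mean s n (g h : n.-tuple R -> R) : 0 <= s <= 1 ->
  (forall y, g y <= h y) -> reveal_mean s g <= reveal_mean s h.
Proof.
move=> /andP[s0 s1]; elim: n g h => //= n IH g h gh.
by rewrite lerD// ler_wpM2l ?lerD ?subr_ge0 ?divr_ge0 ?IH.
Qed.

Lemma reveal_mean_ge0 s n (g : n.-tuple R -> R) : 0 <= s <= 1 ->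
  (forall y, 0 <= g y) -> 0 <= reveal_mean s g.
Proof.
move=> /andP[s0 s1]; elim: n g => //= n IH g g0.
have IHc c : 0 <= reveal_mean s (fun y : n.-tuple R => g [tuple of c :: y]).
  by apply: IH => y; exact: g0.
apply: addr_ge0; apply: mulr_ge0; rewrite ?subr_ge0 ?divr_ge0//.
exact: addr_ge0.
Qed.

(** Convexity of z^q at the normalized points u / U and v / V, with weights U / (U + V) and V / (U +
    V). Norm bounds are phrased through q-th powers to avoid roots of means. *)
Lemma reveal_mean_minkowski_pos s n q (u v : n.-tuple R -> R) (U V : R) :
  0 <= s <= 1 -> 1 <= q -> (forall y, 0 <= u y) -> (forall y, 0 <= v y) ->
  0 < U -> 0 < V ->
  reveal_mean s (fun y => u y `^ q) <= U `^ q ->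
  reveal_mean s (fun y => v y `^ q) <= V `^ q ->
  reveal_mean s (fun y => (u y + v y) `^ q) <= (U + V) `^ q.
Proof.
move=> s01 q1 u0 v0 U0 V0 hu hv.
have UV0 : 0 < U + V by rewrite addr_gt0.
have th0 : 0 <= U / (U + V) by rewrite divr_ge0// ltW.
have th1 : U / (U + V) <= 1 by rewrite ler_pdivrMr// mul1r lerDl ltW.
have Uq := powR_gt0 q U0; have Vq := powR_gt0 q V0.
(* Convexity gives (u + v)^q <= c u^q + d v^q pointwise, while c U^q + d V^q is exactly (U +
   V)^q. *)
pose c := (U + V) `^ q * (U / (U + V)) / U `^ q.
pose d := (U + V) `^ q * (V / (U + V)) / V `^ q.
have c0 : 0 <= c by rewrite /c !mulr_ge0 ?invr_ge0 ?powR_ge0// ltW.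
have d0 : 0 <= d by rewrite /d !mulr_ge0 ?invr_ge0 ?powR_ge0// ltW.
have -> : (U + V) `^ q = c * U `^ q + d * V `^ q.
  by rewrite /c /d; field; rewrite !gt_eqF.
apply: (@le_trans _ _ (reveal_mean s (fun y => c * u y `^ q + d * v y `^ q))).
  apply: ler_reveal_mean => // y.
  have uU : 0 <= u y / U by rewrite divr_ge0// ltW.
  have vV : 0 <= v y / V by rewrite divr_ge0// ltW.
  have := @convex_powR R q q1 (Itv01 th0 th1) (u y / U) (v y / V).
  rewrite !inE/= !in_itv/= !andbT => /(_ uU vV).
  rewrite convRE [X in X `^ _ <= _]convRE/= /unstable.onem.
  have -> : U / (U + V) * (u y / U) + (1 - U / (U + V)) * (v y / V)
            = (u y + v y) / (U + V) by field; rewrite !gt_eqF.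
  move=> H.
  have -> : u y + v y = (U + V) * ((u y + v y) / (U + V)).
    by field; rewrite gt_eqF.
  rewrite powRM ?divr_ge0 ?addr_ge0 ?(ltW U0) ?(ltW V0)//.
  have /le_trans -> // := ler_wpM2l (powR_ge0 (U + V) q) H.
  rewrite [in leLHS]powRM ?invr_ge0 ?(ltW U0)//.
  rewrite [in leLHS]powRM ?invr_ge0 ?(ltW V0)//.
  rewrite -[U^-1]powR_inv1 ?(ltW U0)// -[V^-1]powR_inv1 ?(ltW V0)//.
  rewrite -!powRrM !mulN1r !powRN /c /d le_eqVlt; apply/orP; left; apply/eqP.
  by field; rewrite !gt_eqF.
by rewrite reveal_mean_linear lerD// ler_wpM2l.
Qed.

(** To admit U = 0 or V = 0, both are raised by d / 2; after taking q-th roots, d tends to 0. *)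
Lemma reveal_mean_minkowski s n q (u v : n.-tuple R -> R) (U V : R) :
  0 <= s <= 1 -> 1 <= q -> (forall y, 0 <= u y) -> (forall y, 0 <= v y) ->
  0 <= U -> 0 <= V ->
  reveal_mean s (fun y => u y `^ q) <= U `^ q ->
  reveal_mean s (fun y => v y `^ q) <= V `^ q ->
  reveal_mean s (fun y => (u y + v y) `^ q) <= (U + V) `^ q.
Proof.
move=> s01 q1 u0 v0 U0 V0 hu hv; set E := reveal_mean _ _.
have q0 : 0 < q by lra.
have E0 : 0 <= E by apply: reveal_mean_ge0 => // y; exact: powR_ge0.
have Eq : E = (E `^ q^-1) `^ q by rewrite -powRrM mulVf ?gt_eqF// powRr1.
rewrite Eq; apply: ge0_ler_powR; rewrite ?nnegrE ?powR_ge0 ?addr_ge0 ?(ltW q0)//.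
apply/ler_addgt0Pr => d d0.
have UVd : 0 <= U + V + d by lra.
have -> : U + V + d = ((U + V + d) `^ q) `^ q^-1.
  by rewrite -powRrM mulfV ?gt_eqF// powRr1.
apply: ge0_ler_powR; rewrite ?nnegrE ?powR_ge0 ?invr_ge0 ?(ltW q0)//.
have -> : U + V + d = (U + d / 2) + (V + d / 2) by field.
apply: reveal_mean_minkowski_pos => //; try lra.
  apply: (le_trans hu); apply: ge0_ler_powR; rewrite ?nnegrE ?(ltW q0)//; lra.
apply: (le_trans hv); apply: ge0_ler_powR; rewrite ?nnegrE ?(ltW q0)//; lra.
Qed.

(** A coefficient-free form of multilinearity, stable under fixing the first coordinate and under
    differences, as the induction on n requires. The parameter l ranges over all reals, so values
    may be extrapolated. *)
Definition coordinatewise_affine n (g : n.-tuple R -> R) : Prop :=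
  forall (i : 'I_n) (y z w : n.-tuple R) (l : R),
    (forall j, j != i -> tnth y j = tnth w j /\ tnth z j = tnth w j) ->
    tnth w i = (1 - l) * tnth y i + l * tnth z i ->
    g w = (1 - l) * g y + l * g z.

Lemma coordinatewise_affine_cons n (g : n.+1.-tuple R -> R) (c : R) :
  coordinatewise_affine g -> coordinatewise_affine (fun y => g [tuple of c :: y]).
Proof.
move=> gA i y z w l yzw wi; apply: (gA (lift ord0 i)); last by rewrite !tnthS.
move=> j; have [j'|] := unliftP ord0 j; last first.
  by move=> ->; rewrite !tnth0.
move=> ->; rewrite (inj_eq lift_inj) => /yzw; by rewrite !tnthS.
Qed.

Lemma coordinatewise_affineB n (g h : n.-tuple R -> R) :
  coordinatewise_affine g -> coordinatewise_affine h ->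
  coordinatewise_affine (fun y => g y - h y).
Proof.
move=> gA hA i y z w l yzw wi.
by rewrite (gA i y z w l)// (hA i y z w l)//; ring.
Qed.

Lemma coordinatewise_affine_head n (g : n.+1.-tuple R -> R) (c : R) (y : n.-tuple R) :
  coordinatewise_affine g ->
  g [tuple of c :: y] =
  g [tuple of 0 :: y] + c * (g [tuple of 1 :: y] - g [tuple of 0 :: y]).
Proof.
(* The parameter on the line from head 0 to head 1 is l = c itself; c = -1 will be an
   extrapolation. *)
move=> gA; rewrite (gA ord0 [tuple of 0 :: y] [tuple of 1 :: y] _ c).
- by ring.
- move=> j; have [j'|] := unliftP ord0 j; last by move=> ->; rewrite eqxx.
  by move=> -> _; rewrite !tnthS.
- by rewrite !tnth0; ring.
Qed.

(** Writes g as a + y_0 b and averages over y_0. A general [phi] covers both the p-th power and the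
    square. *)
Lemma reveal_mean_affineS s n (g : n.+1.-tuple R -> R) (phi : R -> R) :
  coordinatewise_affine g ->
  let a (y : n.-tuple R) := g [tuple of 0 :: y] in
  let b (y : n.-tuple R) := g [tuple of 1 :: y] - g [tuple of 0 :: y] in
  reveal_mean s (fun y => phi (g y)) =
  reveal_mean s (fun y : n.-tuple R =>
    (1 - s) * phi (a y) + s / 2 * (phi (a y + b y) + phi (a y - b y))).
Proof.
move=> gA a b.
rewrite reveal_mean_linear.
under [X in _ = _ + _ * reveal_mean _ X]eq_fun do
  rewrite -[X in X + _]mul1r -[X in _ + X]mul1r.
rewrite reveal_mean_linear !mul1r /=.
congr (_ + _ * (_ + _)); congr reveal_mean; apply/funext => y; congr phi.
- by rewrite /a /b; ring.
- by rewrite coordinatewise_affine_head// /a /b; ring.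
Qed.

Lemma reveal_mean_hypercontractive t T n (g : n.-tuple R -> R) :
  0 <= t -> t <= T -> T <= 1 -> coordinatewise_affine g ->
  reveal_mean t (fun y => `|g y| `^ (2 + (T - t))) <=
  reveal_mean T (fun y => g y ^+ 2) `^ ((2 + (T - t)) / 2).
Proof.
move=> t0 tT T1; elim: n g => [g _ /=|n IH g gA]; first by rewrite norm_powR_sqr.
have e01 : 0 <= T - t <= 1 by lra.
have t01 : 0 <= t <= 1 by lra.
have T01 : 0 <= T <= 1 by lra.
pose a (y : n.-tuple R) := g [tuple of 0 :: y].
pose b (y : n.-tuple R) := g [tuple of 1 :: y] - g [tuple of 0 :: y].
have aA : coordinatewise_affine a by exact: coordinatewise_affine_cons.
have bA : coordinatewise_affine b.
  by apply: coordinatewise_affineB; exact: coordinatewise_affine_cons.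
rewrite (@reveal_mean_affineS t n g (fun z => `|z| `^ _))//.
rewrite (@reveal_mean_affineS T n g (fun z => z ^+ 2))//.
rewrite -/(a _) -/(b _); set p := 2 + (T - t).
(* For the square, the cross terms of a + b and a - b cancel. *)
under [X in _ <= reveal_mean T X `^ _]eq_fun => y.
  rewrite (_ : _ + _ = 1 * (a y) ^+ 2 + T * (b y) ^+ 2); last first.
    by rewrite /a /b; field.
  over.
rewrite reveal_mean_linear mul1r.
apply: (@le_trans _ _ (reveal_mean t (fun y => (a y ^+ 2 + T * b y ^+ 2) `^ (p / 2)))).
  apply: ler_reveal_mean => // y.
  by have := @single_coordinate_bound R (T - t) t (a y) (b y) e01 t01; rewrite (subrKC t T).
have mean0 (h : n.-tuple R -> R) : 0 <= reveal_mean T (fun y => h y ^+ 2).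
  by apply: reveal_mean_ge0 => // y; exact: sqr_ge0.
have T0 : 0 <= T by lra.
(* Here U and V are the means at time T of a^2 and T b^2; the two norm bounds are the induction
   hypothesis for a and for b. *)
apply: (@reveal_mean_minkowski t n (p / 2) (fun y => a y ^+ 2) (fun y => T * b y ^+ 2)) => //.
- by rewrite /p; lra.
- by move=> y; exact: sqr_ge0.
- by move=> y; rewrite mulr_ge0// sqr_ge0.
- by rewrite mulr_ge0.
- under eq_fun do rewrite -norm_powR_sqr; exact: IH.
- rewrite powRM//.
  under eq_fun do rewrite powRM ?sqr_ge0// -norm_powR_sqr.
  by rewrite reveal_meanZ ler_wpM2l ?powR_ge0// IH.
Qed.

Lemma coordinatewise_affine_multilinear n (c : {set 'I_n} -> R) :
  coordinatewise_affine
    (fun y => \sum_(S : {set 'I_n}) c S * \prod_(j in S) tnth y j).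
Proof.
move=> i y z w l yzw wi; rewrite !mulr_sumr -big_split/=.
apply: eq_bigr => S _.
rewrite !(mulrCA _ (c S)) -mulrDr; congr (_ * _).
(* A monomial is constant in coordinate i when i is outside S, and otherwise has that coordinate as
   a single factor. *)
have [iS|iS] := boolP (i \in S); last first.
  have e v : (forall j, j != i -> tnth v j = tnth w j) ->
      \prod_(j in S) tnth v j = \prod_(j in S) tnth w j.
    move=> vw; apply: eq_bigr => j jS; apply: vw.
    by apply: contraNneq iS => <-.
  by rewrite (e y) ?(e z) => [|j /yzw[]|j /yzw[]]//; ring.
rewrite !(bigD1 i iS)/=.
have e v : (forall j, j != i -> tnth v j = tnth w j) ->
    \prod_(j in S | j != i) tnth v j = \prod_(j in S | j != i) tnth w j.
  by move=> vw; apply: eq_bigr => j /andP[_ ji]; exact: vw.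
by rewrite wi (e y) ?(e z) => [|j /yzw[]|j /yzw[]]//; ring.
Qed.

End RevealMean.

(** * The law of the process, through its finitely many sign and reveal patterns *)

Section RevealingProcessLaw.
Set Implicit Arguments.
Unset Strict Implicit.
Variable R : realType.

(* A pair [(r, b)] records, for one coordinate, whether it is revealed and
   whether its sign is positive. *)
Definition cell_sign (c : bool * bool) : R := if c.2 then 1 else -1.
Definition cell_value (c : bool * bool) : R := if c.1 then cell_sign c else 0.
Definition cell_mass (s : R) (c : bool * bool) : R := if c.1 then s else 1 - s.

(** Each coordinate has four cells for three values: the two unrevealed cells share the value 0, and
    their masses (1 - s) / 2 add up to 1 - s. Keeping hidden signs makes every cell a product
    event. *)
Lemma reveal_mean_cells (s : R) n (g : n.-tuple R -> R) :
  reveal_mean s g =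
  \sum_(c : n.-tuple (bool * bool))
    (2 ^+ n)^-1 * (\prod_(i < n) cell_mass s (tnth c i)) *
    g [tuple cell_value (tnth c i) | i < n].
Proof.
elim: n g => [|n IH] g.
  rewrite (big_pred1 [tuple])/=; last by move=> c; apply/esym/eqP/tuple0.
  by rewrite big_ord0 invr1 !mul1r; congr g; apply/esym/tuple0.
pose consp (p : (bool * bool) * n.-tuple (bool * bool)) := [tuple of p.1 :: p.2].
rewrite (reindex consp)/=; last first.
  exists (fun c => (thead c, [tuple of behead c])) => [[h c] _|c _].
    by congr (_, _); apply: val_inj.
  by rewrite /consp/= -tuple_eta.
pose G (v : R) (c : n.-tuple (bool * bool)) :=
  (2 ^+ n)^-1 * (\prod_(i < n) cell_mass s (tnth c i)) *
    g [tuple of v :: [tuple cell_value (tnth c i) | i < n]].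
rewrite (eq_bigr (fun p => cell_mass s p.1 / 2 * G (cell_value p.1) p.2)); last first.
  move=> [h c] _; rewrite /consp/= big_ord_recl tnth0 /G.
  rewrite (eq_bigr (fun i => cell_mass s (tnth c i))); last first.
    by move=> i _; rewrite tnthS.
  have -> : [tuple cell_value (tnth [tuple of h :: c] i) | i < n.+1] =
            [tuple of cell_value h :: [tuple cell_value (tnth c i) | i < n]].
    apply: eq_from_tnth => i; rewrite tnth_mktuple.
    have [j|] := unliftP ord0 i; last by move=> ->; rewrite !tnth0.
    by move=> ->; rewrite !tnthS tnth_mktuple.
  by rewrite exprS invfM; ring.
rewrite -(pair_bigA _ (fun h c => cell_mass s h / 2 * G (cell_value h) c))/=.
rewrite -(pair_bigA _ (fun r b => \sum_c cell_mass s (r, b) / 2 * G (cell_value (r, b)) c))/=.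
rewrite !big_bool/= !IH -!mulr_sumr -/(G _ _) /cell_mass /cell_value /cell_sign/=.
by field.
Qed.

Lemma uniform_prob_itvNyc (s : R) : 0 <= s <= 1 ->
  uniform_prob (@ltr01 R) `]-oo, s] = s%:E.
Proof.
move=> /andP[s0 s1]; rewrite /uniform_prob integral_uniform_pdf.
have -> : `]-oo, s]%classic `&` `[0, 1]%classic = `[0, s]%classic :> set R.
  apply/seteqP; split => y /=; rewrite !in_itv/=.
    by move=> [-> /andP[->]].
  by move=> /andP[y0 ys]; rewrite y0 ys (le_trans ys s1).
rewrite (eq_integral (fun=> 1%:E)); last first.
  move=> y; rewrite inE/= in_itv/= /uniform_pdf => /andP[-> ys].
  by rewrite (le_trans ys s1)/= subr0 invr1.
rewrite integral_cst//= lebesgue_measure_itv/= lte_fin mul1e.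
case: ltP => [_|s0']; first by rewrite oppr0 adde0.
by congr EFin; apply/eqP; rewrite eq_le s0 s0'.
Qed.

Lemma measurable_tuple_box n (B : 'I_n -> set R) :
  (forall i, measurable (B i)) ->
  measurable [set y : n.-tuple R | forall i, B i (tnth y i)].
Proof.
move=> mB.
have -> : [set y : n.-tuple R | forall i, B i (tnth y i)] =
    \bigcap_(i in [set: 'I_n]) ((fun y : n.-tuple R => tnth y i) @^-1` B i).
  by apply/seteqP; split => [y /= h i _|y h i]; [exact: h|exact: (h i)].
apply: fin_bigcap_measurable => // i _.
by rewrite -[X in measurable X]setTI; exact: measurable_tnth.
Qed.

Lemma measurable_tuple_set1 n (v : n.-tuple R) : measurable [set v].
Proof.
rewrite (_ : [set v] = [set y | forall i, [set tnth v i] (tnth y i)]).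
  exact: (@measurable_tuple_box n (fun i => [set tnth v i])).
by apply/seteqP; split => [y /= -> //|y /= h]; exact: eq_from_tnth.
Qed.

Definition time_set (s : R) (r : bool) : set R :=
  if r then `]-oo, s]%classic else ~` `]-oo, s]%classic.

Lemma measurable_time_set (s : R) r : measurable (time_set s r).
Proof. by case: r => //=; exact: measurableC. Qed.

Lemma time_setP (s : R) r y : time_set s r y <-> (y <= s) = r.
Proof.
case: r => /=; rewrite /time_set/= in_itv/=; first by split.
by split => [/negP/negbTE|->].
Qed.

Variables (d : measure_display) (Omega : measurableType d).
Variables (P : probability Omega R) (n : nat) (x tau : {RV P >-> n.-tuple R}).
Hypothesis hxtau : revealing_data x tau.

Lemma probability_time_set (s : R) (i : 'I_n) (r : bool) : 0 <= s <= 1 ->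
  P ((fun w => tnth (tau w) i) @^-1` time_set s r) = (if r then s else 1 - s)%:E.
Proof.
move=> s01; rewrite (tau_uniform hxtau); last exact: measurable_time_set.
case: r => /=; first exact: uniform_prob_itvNyc.
rewrite /time_set probability_setC// EFinB; congr (1 - _)%E.
exact: uniform_prob_itvNyc.
Qed.

Definition sign_set (c : n.-tuple (bool * bool)) : set (n.-tuple R) :=
  [set [tuple cell_sign (tnth c i) | i < n]].

Definition times_set (s : R) (c : n.-tuple (bool * bool)) : set (n.-tuple R) :=
  [set y | forall i, time_set s (tnth c i).1 (tnth y i)].

Definition cell_event (s : R) (c : n.-tuple (bool * bool)) : set Omega :=
  x @^-1` sign_set c `&` tau @^-1` times_set s c.

Lemma measurable_times_set s c : measurable (times_set s c).
Proof.
apply: (@measurable_tuple_box n (fun i => time_set s (tnth c i).1)) => i.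
exact: measurable_time_set.
Qed.

Lemma measurable_cell_event s c : measurable (cell_event s c).
Proof.
apply: measurableI; apply: measurable_funPTI.
  exact: measurable_tuple_set1.
exact: measurable_times_set.
Qed.

Lemma probability_cell_event (s : R) c : 0 <= s <= 1 ->
  P (cell_event s c) =
  ((2 ^+ n)^-1 * \prod_(i < n) cell_mass s (tnth c i))%:E.
Proof.
move=> s01; rewrite /cell_event (x_tau_independent hxtau); last 2 first.
- exact: measurable_tuple_set1.
- exact: measurable_times_set.
rewrite EFinM; congr (_ * _)%E.
  apply: (x_uniform hxtau) => i; rewrite tnth_mktuple /cell_sign.
  by case: ifP; [right|left].
(* Mutual independence is used for the full index set. *)
have := tau_independent hxtau [set: 'I_n]%SET
  (fun i => measurable_time_set s (tnth c i).1).
rewrite (eq_bigr (fun i => (cell_mass s (tnth c i))%:E)); last first.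
  by move=> i _; rewrite probability_time_set.
rewrite prodEFin (eq_bigl xpredT) => [<-|i]; last by rewrite inE.
congr (P _); apply/seteqP; split => [w h i _|w h i]; first exact: h.
by apply: (h i); rewrite /= inE.
Qed.

Definition cell_of (s : R) (w : Omega) : n.-tuple (bool * bool) :=
  [tuple (tnth (tau w) i <= s, tnth (x w) i == 1) | i < n].

(** The cells partition [Omega]: every sign is -1 or 1, so testing equality with 1 determines it. *)
Lemma cell_eventP s c w : cell_event s c w <-> c = cell_of s w.
Proof.
split=> [[/= xc tc]|->]; last first.
  split=> /=; last by move=> i; rewrite tnth_mktuple; apply/time_setP.
  apply: eq_from_tnth => i; rewrite !tnth_mktuple /cell_sign/=.
  case: eqP => [//|xN1].
  by have [] := x_sign hxtau w i.
apply: eq_from_tnth => i; rewrite tnth_mktuple xc tnth_mktuple.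
have /time_setP -> := tc i.
rewrite /cell_sign; case: (tnth c i) => r [] /=; rewrite ?eqxx//.
by rewrite lt_eqF// (lt_trans (ltrN10 R) ltr01).
Qed.

Lemma revealing_process_cell s w :
  revealing_process x tau s w = [tuple cell_value (tnth (cell_of s w) i) | i < n].
Proof.
apply: eq_from_tnth => i; rewrite !tnth_mktuple /cell_value /cell_sign/=.
case: ifP => // _; case: eqP => [//|xN1].
by have [] := x_sign hxtau w i.
Qed.

Lemma revealing_process_cube s w : cube (revealing_process x tau s w).
Proof.
move=> i; rewrite tnth_mktuple; case: ifP => _; last by rewrite lerN10 ler01.
by have [->|->] := x_sign hxtau w i; rewrite ?lexx ?andbT; lra.
Qed.

(** Along the process g is a finite combination of cell indicators, which is integrated term by
    term. *)
Lemma expectation_revealing_process (s : R) (g : n.-tuple R -> R) :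
  0 <= s <= 1 -> (forall y, 0 <= g y) ->
  ('E_P[fun w => g (revealing_process x tau s w)] = (reveal_mean s g)%:E)%E.
Proof.
move=> s01 g0; rewrite unlock reveal_mean_cells -sumEFin.
pose v c := g [tuple cell_value (tnth c i) | i < n].
rewrite (eq_integral (fun w => \sum_(c : n.-tuple (bool * bool))
    (v c)%:E * (\1_(cell_event s c) w)%:E)%E); last first.
  move=> w _; rewrite (bigD1 (cell_of s w))//= big1 ?adde0.
    rewrite indicE mem_set ?mule1; last exact/cell_eventP.
    by rewrite revealing_process_cell.
  move=> c cw; rewrite indicE memNset ?mule0//.
  by move=> /cell_eventP; apply/eqP.
rewrite ge0_integral_sum//=; last 2 first.
- move=> c; apply/measurable_EFinP; apply: measurable_funM => //.
  by apply: measurable_indic; exact: measurable_cell_event.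
- by move=> c w _; rewrite mule_ge0 ?lee_fin// /v.
apply: eq_bigr => c _; rewrite ge0_integralZl_EFin//=; last 2 first.
- apply/measurable_EFinP; apply: measurable_indic; exact: measurable_cell_event.
- exact: g0.
rewrite integral_indic//; last exact: measurable_cell_event.
by rewrite setIT [X in (_ * X)%E]probability_cell_event// -EFinM mulrC.
Qed.

End RevealingProcessLaw.

(** * Transfer of hypercontractivity to the process *)

Theorem theorem5p2 (R : realType) (d : measure_display) (Omega : measurableType d)
    (P : probability Omega R) (n : nat) (x tau : {RV P >-> n.-tuple R})
    (hxtau : revealing_data x tau)
    (t T : R) (ht : 0 <= t) (htT : t <= T) (hT : T <= 1)
    (f : n.-tuple R -> R) (hf : multilinear_on_cube f) :
  ('E_P[fun w => (`|f (revealing_process x tau t w)| `^ (2 + (T - t)))%R]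
     `^ (2 + (T - t))^-1
   <= 'E_P[fun w => (`|f (revealing_process x tau T w)| ^+ 2)%R] `^ 2^-1)%E.
Proof.
have [c fc] := hf.
(* The process stays in the cube, where f agrees with this polynomial; unlike f, it is controlled on
   all tuples. *)
pose g (y : n.-tuple R) := \sum_(S : {set 'I_n}) c S * \prod_(j in S) tnth y j.
have fg s w : f (revealing_process x tau s w) = g (revealing_process x tau s w).
  by apply: fc; exact: revealing_process_cube.
under eq_fun do rewrite fg.
under [X in (_ <= 'E_P[X] `^ _)%E]eq_fun do rewrite fg real_normK ?num_real//.
have t01 : 0 <= t <= 1 by rewrite ht (le_trans htT).
have T01 : 0 <= T <= 1 by rewrite (le_trans ht).
have p0 : 0 < 2 + (T - t) by lra.
rewrite (expectation_revealing_process hxtau (g := fun y => `|g y| `^ _))//.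
rewrite (expectation_revealing_process hxtau (g := fun y => g y ^+ 2))//; last first.
  by move=> y; exact: sqr_ge0.
rewrite !poweR_EFin lee_fin.
have := reveal_mean_hypercontractive ht htT hT (@coordinatewise_affine_multilinear R n c).
rewrite -/g; set A := reveal_mean t _; set B := reveal_mean T _ => AB.
(* The recursive bound controls p-th powers, p = 2 + (T - t); taking p-th roots turns B^(p/2) into
   B^(1/2). *)
have -> : B `^ 2^-1 = (B `^ ((2 + (T - t)) / 2)) `^ (2 + (T - t))^-1.
  by rewrite -powRrM; congr (_ `^ _); field; rewrite gt_eqF.
apply: ge0_ler_powR; rewrite ?nnegrE ?powR_ge0 ?invr_ge0 ?(ltW p0)//.
by apply: reveal_mean_ge0 => // y; exact: powR_ge0.
Qed.
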